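(* Let $K$ be an algebraically closed field of characteristic $0$ and let $X$ be a finite set of distinct points in $\mathbb{P}^1\times\mathbb{P}^1\times\mathbb{P}^1$ over $K$. Let $t_1=|\pi_1(X)|$ and $t_2=|\pi_2(X)|$. Then for all integers $k\ge0$, \[ H_X(t_1-1,t_2-1,k)=\sum_{m=1}^{k+1}\left(\sum_{n=m}^{\infty} r_n(X)\right). \]
   Context: Let $R=K[x_0,x_1,y_0,y_1,z_0,z_1]$ be $\mathbb{N}^3$-graded with $\deg x_i=(1,0,0)$, $\deg y_i=(0,1,0)$, $\deg z_i=(0,0,1)$. For a point $P=[a_0:a_1]\times[b_0:b_1]\times[c_0:c_1]$, $I(P)=(a_1x_0-a_0x_1,\,b_1y_0-b_0y_1,\,c_1z_0-c_0z_1)$, and for $X=\{P_1,\dots,P_s\}$, $I(X)=\bigcap_i I(P_i)$. The Hilbert function is $H_X(i,j,k)=\dim_K R_{i,j,k}-\dim_K I(X)_{i,j,k}$. $\pi_i$ is the projection to the $i$-th factor $\mathbb{P}^1$. A line of type $(1,1,0)$ is the subvariety defined by an ideal $(L,L')$ with $L\in R_{1,0,0}$, $L'\in R_{0,1,0}$ nonzero. For $i\ge1$, $r_i(X)$ is the number of lines of type $(1,1,0)$ containing exactly $i$ points of $X$ (zero for all but finitely many $i$). *)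

(* Defs.v *)
From HB Require Import structures.
From mathcomp Require Import all_boot all_order all_algebra.
From mathcomp Require Import mpoly.
From Stdlib Require Import ClassicalEpsilon.
Set Implicit Arguments. Unset Strict Implicit. Unset Printing Implicit Defensive.
Import Order.TTheory GRing.Theory Num.Theory.
Local Open Scope ring_scope.

Section Defs.
Variable K : fieldType.

Definition R := {mpoly K[6]}.

Definition v0 : 'I_6 := inord 0.  Definition v1 : 'I_6 := inord 1.
Definition v2 : 'I_6 := inord 2.  Definition v3 : 'I_6 := inord 3.
Definition v4 : 'I_6 := inord 4.  Definition v5 : 'I_6 := inord 5.
Definition x0 : R := 'X_v0.  Definition x1 : R := 'X_v1.
Definition y0 : R := 'X_v2.  Definition y1 : R := 'X_v3.
Definition z0 : R := 'X_v4.  Definition z1 : R := 'X_v5.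

(* f lies in R_(i,j,k) (the N^3-grading, degrees taken in int so that
   negative degrees give the zero space). *)
Definition homog3 (i j k : int) (f : R) : Prop :=
  forall m : 'X_{1..6}, m \in msupp f ->
    [/\ ((m v0 + m v1)%N)%:Z = i, ((m v2 + m v3)%N)%:Z = j
      & ((m v4 + m v5)%N)%:Z = k].

(* A point of P^1 is given by homogeneous coordinates [a0:a1] (a pair, not both
   zero); a point of P^1 x P^1 x P^1 by a triple of such pairs. *)
Definition pt1 := (K * K)%type.
Definition pt3 := (pt1 * pt1 * pt1)%type.
Definition nz1 (a : pt1) : Prop := a.1 != 0 \/ a.2 != 0.
Definition valid3 (P : pt3) : Prop := [/\ nz1 P.1.1, nz1 P.1.2 & nz1 P.2].
Definition eq1 (a b : pt1) : bool := a.1 * b.2 == a.2 * b.1.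
Definition eq3 (P Q : pt3) : bool :=
  [&& eq1 P.1.1 Q.1.1, eq1 P.1.2 Q.1.2 & eq1 P.2 Q.2].

Definition idealP (P : pt3) (f : R) : Prop :=
  let a := P.1.1 in let b := P.1.2 in let c := P.2 in
  exists g1 g2 g3 : R,
    f = g1 * (a.2 *: x0 - a.1 *: x1) + g2 * (b.2 *: y0 - b.1 *: y1)
        + g3 * (c.2 *: z0 - c.1 *: z1).

Definition idealX (X : seq pt3) (f : R) : Prop := forall P, P \in X -> idealP P f.

Definition lin_comb (b : seq R) (c : 'I_(size b) -> K) : R :=
  \sum_(i < size b) c i *: b`_i.
Definition is_basis (S : R -> Prop) (b : seq R) : Prop :=
  [/\ forall i : 'I_(size b), S b`_i,
      forall c : 'I_(size b) -> K, lin_comb c = 0 -> forall i, c i = 0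
    & forall f, S f -> exists c : 'I_(size b) -> K, f = lin_comb c].
Definition dimK (S : R -> Prop) : nat :=
  epsilon (inhabits 0%N) (fun d => exists b, size b = d /\ is_basis S b).

Definition Rdeg (i j k : int) (f : R) : Prop := homog3 i j k f.
Definition IXdeg (X : seq pt3) (i j k : int) (f : R) : Prop :=
  homog3 i j k f /\ idealX X f.

Definition hilbX (X : seq pt3) (i j k : int) : int :=
  (dimK (Rdeg i j k))%:Z - (dimK (IXdeg X i j k))%:Z.

Definition nclasses (T : Type) (e : T -> T -> bool) (x0 : T) (s : seq T) : nat :=
  \sum_(i < size s | [forall j : 'I_(size s), (j < i)%N ==> ~~ e (nth x0 s j) (nth x0 s i)]) 1.

Definition t1 (X : seq pt3) : nat := nclasses eq1 (0,0) [seq P.1.1 | P <- X].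
Definition t2 (X : seq pt3) : nat := nclasses eq1 (0,0) [seq P.1.2 | P <- X].

(* Lines of type (1,1,0): given by nonzero L = l0 x0 + l1 x1 in R_(1,0,0) and
   L' = l0' y0 + l1' y1 in R_(0,1,0); represented by their coefficient pairs. *)
Definition line := (pt1 * pt1)%type.
Definition valid_line (L : line) : Prop := nz1 L.1 /\ nz1 L.2.
Definition on_line (L : line) (P : pt3) : bool :=
  (L.1.1 * P.1.1.1 + L.1.2 * P.1.1.2 == 0) &&
  (L.2.1 * P.1.2.1 + L.2.2 * P.1.2.2 == 0).
Definition same_line (L M : line) : Prop :=
  forall P, valid3 P -> on_line L P = on_line M P.
Definition npts_on (X : seq pt3) (L : line) : nat := count (on_line L) X.
Definition r_count_is (X : seq pt3) (i : nat) (n : nat) : Prop :=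
  exists Ls : seq line,
    [/\ size Ls = n,
        forall l, l \in Ls -> valid_line l /\ npts_on X l = i,
        forall a b : 'I_(size Ls), a != b -> ~ same_line Ls`_a Ls`_b
      & forall M, valid_line M -> npts_on X M = i ->
          exists2 l, l \in Ls & same_line l M].
Definition r (X : seq pt3) (i : nat) : nat :=
  epsilon (inhabits 0%N) (r_count_is X i).

Definition distinct_points (X : seq pt3) : Prop :=
  (forall P, P \in X -> valid3 P) /\
  (forall a b : 'I_(size X), a != b -> ~~ eq3 (nth ((0,0),(0,0),(0,0)) X a) (nth ((0,0),(0,0),(0,0)) X b)).

End Defs.

(* Main.v *)
Require Import Defs.
From HB Require Import structures.
From mathcomp Require Import all_boot all_order all_algebra.
From mathcomp Require Import mpoly ring zify.
From Stdlib Require Import ClassicalEpsilon.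
Import Order.TTheory GRing.Theory Num.Theory.
Local Open Scope ring_scope.

Set Implicit Arguments.
Unset Strict Implicit.
Unset Printing Implicit Defensive.

(** On each line of type (1,1,0) keep the first [k + 1] points of [X] (all of them
    if there are fewer), and let [Y] be the resulting set.  Evaluation at [Y] maps the
    forms of degree [(t1 - 1, t2 - 1, k)] onto [K^Y]: products of linear forms in the
    x's and in the y's isolate a line, and at most [k] linear forms in the z's isolate
    a point on it.  Its kernel is the degree part of [I(X)]: on a line, a form of
    degree [k] in the z's with [k + 1] zeros vanishes identically.  So the Hilbert
    function is [|Y|].  Finally, the points of [Y] that are m-th on their line are in
    bijection with the lines containing at least [m] points. *)

(** * Dimensions of spaces of polynomials as matrix ranks *)

Section Dimension.
Variable K : fieldType.

Lemma dimK_spec (S : R K -> Prop) d :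
  (exists b, size b = d /\ is_basis S b) ->
  (forall b, is_basis S b -> size b = d) -> dimK S = d.
Proof.
move=> Sd S_uniq.
have := epsilon_spec (inhabits 0%N)
  (fun d => exists b, size b = d /\ is_basis S b) (ex_intro _ d Sd).
by rewrite -/(dimK S) => -[b [<- /S_uniq]].
Qed.

Variables (ms : seq 'X_{1..6}).
Hypothesis ms_uniq : uniq ms.
Let N := size ms.

(** Coordinates on the span of the monomials in [ms], through which subspaces become row spaces. *)
Definition comb_mon (u : 'rV[K]_N) : R K := \sum_(l < N) u 0 l *: 'X_[nth 0%MM ms l].

Lemma comb_mon_coef u (l : 'I_N) : (comb_mon u)@_(nth 0%MM ms l) = u 0 l.
Proof.
rewrite /comb_mon raddf_sum (bigD1 l) //= mcoeffZ mcoeffX eqxx mulr1.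
rewrite big1 ?addr0 // => j jl.
by rewrite mcoeffZ mcoeffX nth_uniq // val_eqE (negPf jl) mulr0.
Qed.

Lemma comb_mon_inj : injective comb_mon.
Proof.
by move=> u v uv; apply/rowP=> l; rewrite -!comb_mon_coef uv.
Qed.

Lemma comb_mon_sum (n : nat) (c : 'I_n -> K) (u : 'I_n -> 'rV[K]_N) :
  \sum_i c i *: comb_mon (u i) = comb_mon (\sum_i c i *: u i).
Proof.
rewrite /comb_mon.
under eq_bigr do rewrite scaler_sumr.
rewrite exchange_big; apply: eq_bigr => l _ /=.
rewrite summxE scaler_suml; apply: eq_bigr => i _.
by rewrite !mxE scalerA.
Qed.

Lemma msupp_comb_mon u : {subset msupp (comb_mon u) <= ms}.
Proof.
move=> m; rewrite mcoeff_msupp; apply: contraR => mNms.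
rewrite /comb_mon raddf_sum big1 // => l _ /=.
rewrite mcoeffZ mcoeffX; case: eqP => [e|_]; last by rewrite mulr0.
by rewrite -e mem_nth in mNms.
Qed.

Lemma comb_mon_surj (f : R K) : {subset msupp f <= ms} -> exists u, f = comb_mon u.
Proof.
move=> fms; exists (\row_l f@_(nth 0%MM ms l)); apply/mpolyP => m.
case: (boolP (m \in ms)) => [/(nthP 0%MM)[l lN <-]|mNms].
  by rewrite (comb_mon_coef _ (Ordinal lN)) mxE.
rewrite !memN_msupp_eq0 //; first by apply: contra mNms; exact: msupp_comb_mon.
by apply: contra mNms; exact: fms.
Qed.

(** The rows of [row_base A] give a basis; any other basis forms a row-free matrix [U] with the row
    space of [A], which forces its size. *)
Lemma dimK_row_space m (A : 'M[K]_(m, N)) (S : R K -> Prop) :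
  (forall f, S f <-> exists2 u, (u <= A)%MS & f = comb_mon u) ->
  dimK S = \rank A.
Proof.
move=> SA; apply: dimK_spec.
  (* The default 0 is never reached: every index is below [\rank A]. *)
  pose b := mkseq (fun i => if insub i is Some j
    then comb_mon (row j (row_base A)) else 0) (\rank A).
  have sz_b : size b = \rank A by rewrite size_mkseq.
  have bE (i : 'I_(size b)) : b`_i = comb_mon (row (cast_ord sz_b i) (row_base A)).
    have iA : (i < \rank A)%N by rewrite -sz_b.
    rewrite nth_mkseq // insubT /=; congr (comb_mon (row _ _)); exact: val_inj.
  have combE (c : 'I_(size b) -> K) : lin_comb c =
      comb_mon ((\row_i c (cast_ord (esym sz_b) i)) *m row_base A).
    rewrite /lin_comb; under eq_bigr do rewrite bE.
    rewrite comb_mon_sum mulmx_sum_row; congr comb_mon.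
    rewrite (reindex (cast_ord (esym sz_b))) /=; last first.
      by exists (cast_ord sz_b) => i _; rewrite ?cast_ordK ?cast_ordKV.
    by apply: eq_bigr => i _; rewrite mxE cast_ordKV.
  exists b; split=> //; split.
  - move=> i; apply/SA; rewrite bE; eexists; last reflexivity.
    by rewrite (submx_trans (row_sub _ _)) ?eq_row_base.
  - move=> c; rewrite combE => c0 i.
    have : (\row_i c (cast_ord (esym sz_b) i)) *m row_base A = 0.
      by apply: comb_mon_inj; rewrite c0 /comb_mon big1 // => l _; rewrite mxE scale0r.
    move/eqP; rewrite mulmx_free_eq0 ?row_base_free // => /eqP/rowP/(_ (cast_ord sz_b i)).
    by rewrite !mxE cast_ordK.
  - move=> f /SA[u uA ->].
    have /submxP[D ->] : (u <= row_base A)%MS by rewrite eq_row_base.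
    exists (fun i => D 0 (cast_ord sz_b i)); rewrite combE; congr (comb_mon (_ *m _)).
    by apply/rowP=> i; rewrite !mxE cast_ordKV.
move=> b [b_S b_free b_gen].
have /fin_all_exists[u uP] (i : 'I_(size b)) :
    exists u, (u <= A)%MS /\ b`_i = comb_mon u.
  by have /SA[u] := b_S i; exists u.
pose U := \matrix_(i < size b) u i.
have combE (c : 'I_(size b) -> K) : lin_comb c = comb_mon ((\row_i c i) *m U).
  rewrite /lin_comb; under eq_bigr do rewrite (uP _).2.
  by rewrite comb_mon_sum mulmx_sum_row; under [in RHS]eq_bigr do rewrite mxE rowK.
have U_free : row_free U.
  rewrite -kermx_eq0; apply/eqP/row_matrixP => i; rewrite row0.
  have kU0 : row i (kermx U) *m U = 0 by rewrite -row_mul mulmx_ker row0.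
  apply/rowP => j; rewrite [RHS]mxE.
  rewrite -[LHS]/((fun j => row i (kermx U) 0 j) j); apply: b_free.
  rewrite combE (_ : \row_i0 _ = row i (kermx U)); last by apply/rowP => l; rewrite !mxE.
  by rewrite kU0 /comb_mon big1 // => l _; rewrite mxE scale0r.
move/eqP: U_free => <-; apply/eqP; rewrite eqn_leq; apply/andP; split.
  by apply/mxrankS/row_subP => i; rewrite rowK; case: (uP i).
apply/mxrankS/row_subP => i.
have /b_gen[c] : S (comb_mon (row i A)) by apply/SA; eexists; [exact: row_sub|].
by rewrite combE => /comb_mon_inj ->; exact: submxMl.
Qed.

Variables (n : nat) (v : 'I_n -> 'I_6 -> K) (S T : R K -> Prop).
Hypothesis S_ms : forall f, S f <-> {subset msupp f <= ms}.
Hypothesis T_S : forall f, T f <-> S f /\ forall y, f.@[v y] = 0.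
Hypothesis separated :
  forall y, exists2 f, S f & forall y', (f.@[v y'] != 0) = (y' == y).

(* Evaluation at the [n] points maps [S] onto [K^n], with kernel [T]. *)
Lemma dimK_codim : (dimK S)%:Z - (dimK T)%:Z = n%:Z.
Proof.
pose E := \matrix_(l < N, y < n) ('X_[nth 0%MM ms l] : {mpoly K[6]}).@[v y].
have evE u y : (comb_mon u).@[v y] = (u *m E) 0 y.
  rewrite /comb_mon raddf_sum mxE; apply: eq_bigr => l _.
  by rewrite /= mevalZ !mxE.
have -> : dimK S = \rank (1%:M : 'M[K]_N).
  apply: dimK_row_space => f; rewrite S_ms; split.
    by case/comb_mon_surj=> u ->; exists u; rewrite ?submx1.
  by case=> u _ ->; exact: msupp_comb_mon.
have -> : dimK T = \rank (kermx E).
  apply: dimK_row_space => f; rewrite T_S S_ms; split.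
    case=> /comb_mon_surj[u ->] u0; exists u => //; apply/sub_kermxP/rowP => y.
    by rewrite -evE u0 mxE.
  case=> u /sub_kermxP uE ->; split; first exact: msupp_comb_mon.
  by move=> y; rewrite evE uE mxE.
have E_full : \rank E = n.
  apply/eqP; rewrite -[_ == _]/(row_full E) -sub1mx; apply/row_subP => y.
  have [f /S_ms/comb_mon_surj[u ->] uP] := separated y.
  have : (comb_mon u).@[v y] != 0 by rewrite uP eqxx.
  (* Dividing by the value [a] at [y] gives a preimage of the [y]-th basis vector. *)
  set a := _.@[_] => a0; apply/submxP; exists (a^-1 *: u).
  have uE y' : (u *m E) 0 y' = a * (y == y')%:R.
    rewrite -evE; case: (eqVneq y y') => [<-|yy']; first by rewrite mulr1.
    by apply/eqP; rewrite mulr0 -[_ == _]negbK uP eq_sym (negPf yy').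
  rewrite -scalemxAl; apply/rowP => y'.
  by rewrite [LHS]mxE [LHS]mxE [RHS]mxE uE mulrA mulVf // mul1r.
(* Rank-nullity: N - (N - n) = n, where n is at most N as the rank of [E]. *)
rewrite mxrank1 mxrank_ker E_full subzn ?leq_subr // subKn //.
by rewrite -E_full rank_leq_row.
Qed.

End Dimension.

(** * Points, their ideals, and products of linear forms *)

Section Points.
Variable K : fieldType.
Implicit Types (P Q : pt3 K) (f g : R K) (a b c : pt1 K).

Lemma eq1_refl a : eq1 a a.
Proof. by rewrite /eq1 mulrC. Qed.

Lemma eq1_sym a b : eq1 a b = eq1 b a.
Proof. by rewrite /eq1 eq_sym mulrC [a.1 * _]mulrC. Qed.

Lemma eq1_trans b a c : nz1 b -> eq1 a b -> eq1 b c -> eq1 a c.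
Proof.
rewrite /nz1 /eq1 => b0 /eqP ab /eqP bc.
have [b1|b2] := b0.
  apply/eqP/(mulfI b1); transitivity (a.1 * (b.1 * c.2)); first by ring.
  by rewrite bc mulrA ab; ring.
apply/eqP/(mulfI b2); transitivity (a.1 * b.2 * c.2); first by ring.
by rewrite ab -mulrA bc; ring.
Qed.

Definition coords P (i : 'I_6) : K :=
  [:: P.1.1.1; P.1.1.2; P.1.2.1; P.1.2.2; P.2.1; P.2.2]`_i.

Lemma coordsE P : (coords P v0 = P.1.1.1) * (coords P v1 = P.1.1.2) *
  (coords P v2 = P.1.2.1) * (coords P v3 = P.1.2.2) *
  (coords P v4 = P.2.1) * (coords P v5 = P.2.2).
Proof. by rewrite /coords /v0 /v1 /v2 /v3 /v4 /v5 !inordK. Qed.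

Lemma big_ord6 (T : Type) (idx : T) (op : Monoid.law idx) (F : 'I_6 -> T) :
  \big[op/idx]_i F i =
  op (op (op (F v0) (F v1)) (op (F v2) (F v3))) (op (F v4) (F v5)).
Proof.
rewrite !big_ord_recl big_ord0 Monoid.mulm1 !Monoid.mulmA.
by do 5?[congr (op _ _)]; congr (F _); apply: val_inj; rewrite /= ?inordK.
Qed.

Definition xform a : R K := a.2 *: x0 K - a.1 *: x1 K.
Definition yform a : R K := a.2 *: y0 K - a.1 *: y1 K.
Definition zform a : R K := a.2 *: z0 K - a.1 *: z1 K.

Lemma xform_eq0 a Q : ((xform a).@[coords Q] == 0) = eq1 a Q.1.1.
Proof.
by rewrite mevalB !mevalZ !mevalXU !coordsE subr_eq0 eq_sym.
Qed.

Lemma yform_eq0 a Q : ((yform a).@[coords Q] == 0) = eq1 a Q.1.2.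
Proof.
by rewrite mevalB !mevalZ !mevalXU !coordsE subr_eq0 eq_sym.
Qed.

Lemma zform_eq0 a Q : ((zform a).@[coords Q] == 0) = eq1 a Q.2.
Proof.
by rewrite mevalB !mevalZ !mevalXU !coordsE subr_eq0 eq_sym.
Qed.

Lemma idealP0 P : idealP P 0.
Proof. by exists 0, 0, 0; rewrite !mul0r !addr0. Qed.

Lemma idealPD P f g : idealP P f -> idealP P g -> idealP P (f + g).
Proof.
move=> [f1 [f2 [f3 ->]]] [g1 [g2 [g3 ->]]].
by exists (f1 + g1), (f2 + g2), (f3 + g3); ring.
Qed.

Lemma idealPM P f g : idealP P g -> idealP P (f * g).
Proof.
move=> [g1 [g2 [g3 ->]]].
by exists (f * g1), (f * g2), (f * g3); ring.
Qed.

Lemma idealPZ P (c : K) f : idealP P f -> idealP P (c *: f).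
Proof. by rewrite -mul_mpolyC; apply: idealPM. Qed.

Lemma idealP_subM P f f' g g' :
  idealP P (f - f') -> idealP P (g - g') -> idealP P (f * g - f' * g').
Proof.
move=> ff' gg'; have -> : f * g - f' * g' = f * (g - g') + g' * (f - f').
  by ring.
by apply: idealPD; apply: idealPM.
Qed.

Lemma idealP_subX P f f' n : idealP P (f - f') -> idealP P (f ^+ n - f' ^+ n).
Proof. by move=> ff'; rewrite subrXX mulrC; apply: idealPM. Qed.

(** Allowing any [Q] equivalent to [P] lets vanishing pass from one choice of homogeneous
    coordinates to another. *)
Lemma idealP_vanish P Q f : idealP P f -> eq3 P Q -> f.@[coords Q] = 0.
Proof.
move=> [g1 [g2 [g3 ->]]] /and3P[PQ1 PQ2 PQ3].
rewrite !mevalD !mevalM.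
have /eqP -> : (xform P.1.1).@[coords Q] == 0 by rewrite xform_eq0.
have /eqP -> : (yform P.1.2).@[coords Q] == 0 by rewrite yform_eq0.
have /eqP -> : (zform P.2).@[coords Q] == 0 by rewrite zform_eq0.
by rewrite !mulr0 !addr0.
Qed.

(* On the line spanned by [a], both coordinates are multiples of a single form. *)
Lemma parametrize a (u0 u1 : R K) : nz1 a -> exists xi c0 c1 : R K,
  u0 - a.1 *: xi = c0 * (a.2 *: u0 - a.1 *: u1) /\
  u1 - a.2 *: xi = c1 * (a.2 *: u0 - a.1 *: u1).
Proof.
case=> a0.
  exists (a.1^-1 *: u0), 0, (- a.1^-1)%:MP.
  rewrite mul0r scalerA divff // scale1r subrr; split=> //.
  rewrite mul_mpolyC scalerBr !scalerA !mulNr mulVf // scaleN1r opprK.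
  by rewrite scaleNr addrC [a.2 * _]mulrC.
exists (a.2^-1 *: u1), (a.2^-1)%:MP, 0.
rewrite mul0r !scalerA divff // scale1r subrr; split=> //.
by rewrite mul_mpolyC scalerBr !scalerA mulVf // scale1r mulrC.
Qed.

(* Modulo the ideal of [P], a form of degree [(i, j, k)] is its value at [P]
   times one fixed form [xi ^+ i * eta ^+ j * zeta ^+ k]. *)
Lemma vanish_idealP P (i j k : int) f :
  valid3 P -> homog3 i j k f -> f.@[coords P] = 0 -> idealP P f.
Proof.
case=> nzx nzy nzz f_homog fP0.
have [xi [p0 [p1 [xi0 xi1]]]] := parametrize (x0 K) (x1 K) nzx.
have [et [q0 [q1 [et0 et1]]]] := parametrize (y0 K) (y1 K) nzy.
have [ze [r0 [r1 [ze0 ze1]]]] := parametrize (z0 K) (z1 K) nzz.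
have I0 : idealP P (x0 K - P.1.1.1 *: xi) by exists p0, 0, 0; rewrite xi0; ring.
have I1 : idealP P (x1 K - P.1.1.2 *: xi) by exists p1, 0, 0; rewrite xi1; ring.
have I2 : idealP P (y0 K - P.1.2.1 *: et) by exists 0, q0, 0; rewrite et0; ring.
have I3 : idealP P (y1 K - P.1.2.2 *: et) by exists 0, q1, 0; rewrite et1; ring.
have I4 : idealP P (z0 K - P.2.1 *: ze) by exists 0, 0, r0; rewrite ze0; ring.
have I5 : idealP P (z1 K - P.2.2 *: ze) by exists 0, 0, r1; rewrite ze1; ring.
pose Z : R K := xi ^+ absz i * et ^+ absz j * ze ^+ absz k.
suff fZ : idealP P (f - f.@[coords P] *: Z).
  by rewrite fP0 scale0r subr0 in fZ.
rewrite mevalE {1}[f]mpolyE scaler_suml -sumrB big_seq.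
apply: (big_ind (idealP P)); [exact: idealP0|exact: idealPD|].
move=> m /f_homog[mi mj mk]; rewrite -scalerA -scalerBr; apply: idealPZ.
(* The exponents of each pair of variables add up to [i], [j] and [k], so every monomial of [f]
   leads to the same [Z]. *)
have -> : (\prod_l coords P l ^+ m l) *: Z =
    (P.1.1.1 *: xi) ^+ m v0 * (P.1.1.2 *: xi) ^+ m v1 *
    ((P.1.2.1 *: et) ^+ m v2 * (P.1.2.2 *: et) ^+ m v3) *
    ((P.2.1 *: ze) ^+ m v4 * (P.2.2 *: ze) ^+ m v5).
  rewrite big_ord6 /= !coordsE /Z -mi -mj -mk !absz_nat !exprD !exprZn.
  by rewrite -!mul_mpolyC !mpolyCM; ring.
(* The congruences [I0] to [I5] of the six variables multiply up to the monomial. *)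
by rewrite mpolyXE_id big_ord6 /=; do !apply: idealP_subM; apply: idealP_subX.
Qed.

Lemma homog3M (i j k i' j' k' : int) f g : homog3 i j k f -> homog3 i' j' k' g ->
  homog3 (i + i') (j + j') (k + k') (f * g).
Proof.
move=> f_h g_h m /msuppM_le/allpairsP[[m1 m2] /= [/f_h[<- <- <-] /g_h[<- <- <-] ->]].
by rewrite !mnmDE; split; lia.
Qed.

Lemma homog3_1 : homog3 0 0 0 (1 : R K).
Proof. by move=> m; rewrite msupp1 inE => /eqP ->; rewrite !mnm0E. Qed.

Lemma homog3_comb (i j k : int) (u v : 'X_{1..6}) (s t : K) :
  homog3 i j k ('X_[u] : R K) -> homog3 i j k ('X_[v] : R K) ->
  homog3 i j k (s *: 'X_[u] - t *: 'X_[v] : R K).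
Proof.
move=> hu hv m /msuppB_le; rewrite mem_cat => /orP[] /msuppZ_le; first exact: hu.
exact: hv.
Qed.

Lemma homog3_xform a : homog3 1 0 0 (xform a).
Proof.
by apply: homog3_comb => m; rewrite msuppX inE => /eqP ->; rewrite !mnm1E -!val_eqE /= !inordK.
Qed.

Lemma homog3_yform a : homog3 0 1 0 (yform a).
Proof.
by apply: homog3_comb => m; rewrite msuppX inE => /eqP ->; rewrite !mnm1E -!val_eqE /= !inordK.
Qed.

Lemma homog3_zform a : homog3 0 0 1 (zform a).
Proof.
by apply: homog3_comb => m; rewrite msuppX inE => /eqP ->; rewrite !mnm1E -!val_eqE /= !inordK.
Qed.

(** Multiply the forms [L a] for [a] in [A]. Leaving [pr] and [L] free treats the x's, y's and z's
    at once. *)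
Lemma separating_form (pr : pt3 K -> pt1 K) (L : pt1 K -> R K) (i j k : int) :
  (forall a, homog3 i j k (L a)) ->
  (forall a Q, ((L a).@[coords Q] == 0) = eq1 a (pr Q)) ->
  forall (A : seq (pt1 K)) P (d : nat), (size A <= d)%N -> nz1 (pr P) ->
  (forall a, a \in A -> ~~ eq1 a (pr P)) ->
  exists f, [/\ homog3 (d%:Z * i) (d%:Z * j) (d%:Z * k) f, f.@[coords P] != 0 &
    forall Q a, a \in A -> eq1 a (pr Q) -> f.@[coords Q] = 0].
Proof.
move=> L_homog L_eq0 A P d szA nzP.
elim: d A szA => [|d IH] A szA A_P.
  exists 1; split; last by case: A szA {A_P}.
    by rewrite !mul0r; exact: homog3_1.
  by rewrite rmorph1 oner_eq0.
(* When [A] is exhausted, pad with a form that does not vanish at [P]. *)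
have [w [A' [wP szA' A'_P AA']]] : exists w A', [/\ ~~ eq1 w (pr P), (size A' <= d)%N,
    forall a, a \in A' -> ~~ eq1 a (pr P) & {subset A <= w :: A'}].
  case: A szA A_P => [|a A] szA A_P.
    have [w wP] : exists w, ~~ eq1 w (pr P).
      case: nzP => nz; [exists (0, 1)|exists (1, 0)]; rewrite /eq1 /=.
        by rewrite mul0r mul1r eq_sym.
      by rewrite mul0r mul1r.
    by exists w, [::].
  exists a, A; split=> //; first by rewrite A_P ?mem_head.
  by move=> b bA; rewrite A_P // inE bA orbT.
have [g [g_homog gP g0]] := IH A' szA' A'_P.
exists (L w * g); split.
- by rewrite intS !mulrDl !mul1r; apply: homog3M.
- by rewrite mevalM mulf_neq0 // L_eq0.
move=> Q a /AA'; rewrite inE mevalM => /predU1P[->|aA'] aQ.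
  by move: aQ; rewrite -L_eq0 => /eqP ->; rewrite mul0r.
by rewrite (g0 Q a) // mulr0.
Qed.

End Points.

(** * Zeros of a form along a line of type (1,1,0) *)

Section Fiber.
Variable K : closedFieldType.
Implicit Types (a b c q w : pt1 K) (f : R K).

(** Each [c] forbids at most one [s] in [1 : s], the root of its factor in [p]; a nonzero polynomial
    over an algebraically closed field has a non-root. *)
Lemma avoid_points (A : seq (pt1 K)) : (forall c, c \in A -> nz1 c) ->
  exists w, forall c, c \in A -> ~~ eq1 c w.
Proof.
move=> nzA; pose p : {poly K} := \prod_(c <- A) (c.2%:P - c.1 *: 'X).
have : p != 0.
  rewrite prodf_seq_neq0; apply/allP => c /nzA nzc /=.
  apply/negP => /eqP c0; case: nzc => /negP; apply.
    have := congr1 (fun r : {poly K} => r`_1) c0.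
    by rewrite coefB coefZ coefC coefX coef0 sub0r mulr1 => /eqP; rewrite oppr_eq0.
  have := congr1 (fun r : {poly K} => r`_0) c0.
  by rewrite coefB coefZ coefC coefX coef0 mulr0 subr0 => ->.
case/closed_nonrootP => s; rewrite /root horner_prod prodf_seq_neq0 => /allP ps.
exists (1, s) => c /ps /=; rewrite !hornerE /eq1 mulr1.
by apply: contra => /eqP ->; rewrite subrr.
Qed.

(** Along t -> q + t w in the third factor, [f] becomes a polynomial [G] in t of degree at most [k]
    with more than [k] roots; its value at t = 0 is the one sought. *)
Lemma fiber_zeros (k : nat) (i j : int) a b q (C : seq (pt1 K)) f :
  homog3 i j k%:Z f -> nz1 a -> nz1 b -> nz1 q ->
  (forall c, c \in C -> nz1 c) -> uniq C -> {in C &, forall c d, eq1 c d -> c = d} ->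
  (k < size C)%N -> (forall c, c \in C -> f.@[coords (a, b, c)] = 0) ->
  f.@[coords (a, b, q)] = 0.
Proof.
move=> f_homog nza nzb nzq nzC C_uniq C_inj szC fC0.
(* As [w] differs from [q], distinct points have distinct parameters; as it differs from each [c],
   each [c] has a finite parameter. *)
have [w w_out] : exists w, forall c, c \in q :: C -> ~~ eq1 c w.
  by apply: avoid_points => c; rewrite inE => /predU1P[->|/nzC].
pose h (l : 'I_6) : {poly K} :=
  [:: a.1%:P; a.2%:P; b.1%:P; b.2%:P; q.1%:P + w.1 *: 'X; q.2%:P + w.2 *: 'X]`_l.
pose G := \sum_(m <- msupp f) f@_m *: \prod_l h l ^+ m l.
have hE : (h v0 = a.1%:P) * (h v1 = a.2%:P) * (h v2 = b.1%:P) * (h v3 = b.2%:P) *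
  (h v4 = q.1%:P + w.1 *: 'X) * (h v5 = q.2%:P + w.2 *: 'X).
  by rewrite /h /v0 /v1 /v2 /v3 /v4 /v5 !inordK.
pose pt t : pt3 K := (a, b, (q.1 + t * w.1, q.2 + t * w.2)).
have GE t : G.[t] = f.@[coords (pt t)].
  rewrite mevalE horner_sum; apply: eq_bigr => m _.
  rewrite hornerZ !big_ord6 /= !hE !coordsE !hornerM !horner_exp !hornerE /=.
  by rewrite [w.1 * t]mulrC [w.2 * t]mulrC.
have szG : (size G <= k.+1)%N.
  apply: (leq_trans (size_sum _ _ _)); apply/bigmax_leqP_seq => m mf _.
  have [_ _ mk] := f_homog m mf.
  apply: (leq_trans (size_scale_leq _ _)).
  have sz_lin (s t : K) n : (size ((s%:P + t *: 'X) ^+ n)%R <= n.+1)%N.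
    have sz2 : (size (s%:P + t *: 'X)%R <= 2)%N.
      rewrite (leq_trans (size_polyD _ _)) // geq_max (leq_trans (size_polyC_leq1 _)) //=.
      by rewrite (leq_trans (size_scale_leq _ _)) ?size_polyX.
    apply: (leq_trans (size_poly_exp_leq _ _)).
    by rewrite ltnS -[leqRHS]mul1n leq_mul2r -subn1 leq_subLR sz2 orbT.
  (* Only the two z-variables contribute to the degree, and their exponents add up to [k]. *)
  rewrite big_ord6 /= !hE -!polyC_exp -!polyCM.
  rewrite mul_polyC; apply: (leq_trans (size_scale_leq _ _)).
  apply: (leq_trans (size_polyMleq _ _)).
  have := sz_lin q.1 w.1 (m v4); have := sz_lin q.2 w.2 (m v5).
  by move: (size _) (size _) => n1 n2; lia.
(* The parameter of the point of the line through [q] and [w] that represents [c]. *)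
pose tc c := (q.1 * c.2 - q.2 * c.1) / (c.1 * w.2 - c.2 * w.1).
have den0 c : c \in q :: C -> c.1 * w.2 - c.2 * w.1 != 0.
  by move=> /w_out; rewrite subr_eq0.
have G0 : G = 0.
  apply/eqP; apply: contraLR szG => G_neq0; rewrite -ltnNge.
  apply: leq_ltn_trans szC _; rewrite -(size_map tc).
  apply: max_poly_roots => //.
    apply/allP => _ /mapP[c cC ->]; rewrite /root GE; apply/eqP.
    (* [pt (tc c)] and [(a, b, c)] are coordinates of the same point. *)
    apply: (@idealP_vanish _ (a, b, c)).
      by apply: (vanish_idealP (i := i) (j := j) (k := k)); rewrite ?fC0 //; split; rewrite //=; exact: nzC.
    rewrite /eq3 !eq1_refl /= /eq1 /= /tc.
    have /den0 d0 : c \in q :: C by rewrite inE cC orbT.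
    by apply/eqP; field.
  rewrite map_inj_in_uniq // => c d cC dC tcd; apply: C_inj => //.
  have /den0 c0 : c \in q :: C by rewrite inE cC orbT.
  have /den0 d0 : d \in q :: C by rewrite inE dC orbT.
  have /den0 q0 : q \in q :: C by rewrite mem_head.
  move/eqP: tcd; rewrite /tc eqr_div // -subr_eq0 => /eqP tcd.
  (* By the Plücker relation, equal parameters make the determinant of [q], [w] times that of [c],
     [d] zero. *)
  rewrite /eq1 -subr_eq0; apply/eqP/(mulfI q0); rewrite mulr0 -oppr0 -tcd.
  by ring.
have := GE 0; rewrite G0 horner0 /pt !mul0r !addr0 => ->.
by case: (q).
Qed.

End Fiber.

(** * Lines of type (1,1,0) and the numbers [r X n] *)

Section Counting.
Variables (K : fieldType) (X : seq (pt3 K)).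
Implicit Types (P Q : pt3 K).
Hypothesis X_valid : forall P, P \in X -> valid3 P.

(** [nclasses] counts first occurrences, and [find] locates the first element of the class of
    [p]. *)
Lemma nclasses_reps (s : seq (pt1 K)) : (forall a, a \in s -> nz1 a) ->
  exists A, [/\ size A = nclasses (@eq1 K) (0, 0) s, {subset A <= s} &
    forall p, p \in s -> exists2 a, a \in A & eq1 a p].
Proof.
move=> nz_s; pose fst_i := [pred i : 'I_(size s) |
  [forall j : 'I_(size s), (j < i)%N ==> ~~ eq1 (nth (0, 0) s j) (nth (0, 0) s i)]].
exists [seq nth (0, 0) s (val i) | i <- enum fst_i]; split.
- by rewrite size_map -cardE -sum1_card.
- by move=> _ /mapP[i _ ->]; apply: mem_nth; exact: ltn_ord.
move=> p ps; have p_has : has (@eq1 K ^~ p) s by apply/hasP; exists p; rewrite ?eq1_refl.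
have i_s := p_has; rewrite has_find in i_s.
have ip := nth_find (0, 0) p_has.
exists (nth (0, 0) s (find (@eq1 K ^~ p) s)) => //.
apply/mapP; exists (Ordinal i_s) => //; rewrite mem_enum; apply/forallP => j.
apply/implyP => /= ji; apply/negP => e.
have := before_find (0, 0) ji; rewrite (eq1_trans _ e ip) //.
by apply: nz_s; rewrite mem_nth.
Qed.

Definition same_fiber P Q := eq1 P.1.1 Q.1.1 && eq1 P.1.2 Q.1.2.

Definition fiber P := [seq Q <- X | same_fiber P Q].

(** Position of [P] among the points of [X] on its line, counted from 0: rank at most [k] means one
    of the first [k + 1]. *)
Definition fiber_rank P := index P (fiber P).

Lemma fiber_mem P : P \in X -> P \in fiber P.
Proof. by move=> PX; rewrite mem_filter /same_fiber !eq1_refl. Qed.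

Lemma same_fiber_sym P Q : same_fiber P Q = same_fiber Q P.
Proof. by rewrite /same_fiber eq1_sym [eq1 P.1.2 _]eq1_sym. Qed.

Lemma same_fiber_trans Q P S : valid3 Q ->
  same_fiber P Q -> same_fiber Q S -> same_fiber P S.
Proof.
move=> [nx ny _] /andP[PQx PQy] /andP[QSx QSy].
by apply/andP; split; [exact: eq1_trans QSx | exact: eq1_trans QSy].
Qed.

Lemma fiber_eq P Q : valid3 P -> valid3 Q -> same_fiber P Q -> fiber P = fiber Q.
Proof.
move=> vP vQ PQ; apply: eq_filter => S; apply/idP/idP; last exact: same_fiber_trans.
by apply: same_fiber_trans; rewrite // same_fiber_sym.
Qed.

(** The line cut out by the generators of I(P) in the x's and in the y's. *)
Definition line_of P : line K := ((P.1.1.2, - P.1.1.1), (P.1.2.2, - P.1.2.1)).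

Lemma on_line_of P Q : on_line (line_of P) Q = same_fiber P Q.
Proof.
by rewrite /on_line /same_fiber /eq1 /= !mulNr !subr_eq0 eq_sym [X in _ && X]eq_sym.
Qed.

Lemma line_of_valid P : valid3 P -> valid_line (line_of P).
Proof.
by move=> [nx ny _]; split; [case: nx|case: ny] => nz;
  rewrite /nz1 /= oppr_eq0; [right|left|right|left].
Qed.

(** The vectors of K^2 killed by a nonzero linear form are proportional; hence a line is determined
    by any of its points. *)
Lemma lin_eq0 (L a b : pt1 K) : nz1 L -> nz1 a -> L.1 * a.1 + L.2 * a.2 = 0 ->
  (L.1 * b.1 + L.2 * b.2 == 0) = eq1 a b.
Proof.
rewrite /eq1 => nzL nza La; apply/eqP/eqP => [Lb|ab].
  apply/eqP; rewrite -subr_eq0; apply/eqP.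
  case: nzL => nzL; apply: (mulfI nzL); rewrite mulr0.
    transitivity (b.2 * (L.1 * a.1 + L.2 * a.2) - a.2 * (L.1 * b.1 + L.2 * b.2)).
      by ring.
    by rewrite La Lb !mulr0 subr0.
  transitivity (a.1 * (L.1 * b.1 + L.2 * b.2) - b.1 * (L.1 * a.1 + L.2 * a.2)).
    by ring.
  by rewrite La Lb !mulr0 subr0.
case: nza => nza; apply: (mulfI nza); rewrite mulr0.
  transitivity (b.1 * (L.1 * a.1 + L.2 * a.2) + L.2 * (a.1 * b.2 - a.2 * b.1)).
    by ring.
  by rewrite La ab subrr !mulr0 addr0.
transitivity (b.2 * (L.1 * a.1 + L.2 * a.2) - L.1 * (a.1 * b.2 - a.2 * b.1)).
  by ring.
by rewrite La ab subrr !mulr0 subr0.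
Qed.

Lemma on_line_fiber (M : line K) P Q : valid_line M -> valid3 P -> on_line M P ->
  on_line M Q = same_fiber P Q.
Proof.
move=> [nM1 nM2] [nx ny _] /andP[/eqP P1 /eqP P2].
by rewrite /on_line (lin_eq0 _ nM1 nx P1) (lin_eq0 _ nM2 ny P2).
Qed.

Lemma npts_on_line_of P : npts_on X (line_of P) = size (fiber P).
Proof. by rewrite size_filter; apply: eq_count => Q; exact: on_line_of. Qed.

(** Sending each line of the first list to the same line in the second is injective, as no line is
    listed twice. By symmetry the count is unique, which pins down the [epsilon] in [r]. *)
Lemma r_count_le i n n' : r_count_is X i n -> r_count_is X i n' -> (n <= n')%N.
Proof.
move=> [Ls [<- LsX Ls_neq _]] [Ls' [<- _ _ Ls'_all]].
have /fin_all_exists[g gP] (a : 'I_(size Ls)) :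
    exists b : 'I_(size Ls'), same_line Ls'`_b Ls`_a.
  have [vL nL] := LsX _ (mem_nth 0 (ltn_ord a)).
  have [l lLs' ll] := Ls'_all _ vL nL.
  have l_lt : (index l Ls' < size Ls')%N by rewrite index_mem.
  by exists (Ordinal l_lt); rewrite nth_index.
have g_inj : injective g.
  move=> a b gab; apply/eqP; apply: contraT => /Ls_neq[] P vP.
  by rewrite -(gP a) // gab (gP b).
by have := leq_card g g_inj; rewrite !card_ord.
Qed.

Lemma rE i n : r_count_is X i n -> r X i = n.
Proof.
move=> Xn; have Xr : r_count_is X i (r X i) by apply: epsilon_spec; exists n.
by apply/eqP; rewrite eqn_leq (r_count_le Xr Xn) (r_count_le Xn Xr).
Qed.

Hypothesis X_uniq : uniq X.

(* A line with [n] points contains exactly one point of each rank below [n]. *)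
Lemma r_count m n : (m < n)%N ->
  r X n = count (fun P => (size (fiber P) == n) && (fiber_rank P == m)) X.
Proof.
move=> mn; apply: rE.
set p := (X in count X _); pose ps := [seq P <- X | p P].
have psP P : P \in ps -> [/\ P \in X, size (fiber P) = n & fiber_rank P = m].
  by rewrite mem_filter => /andP[/andP[/eqP ? /eqP ?] ?].
exists (map line_of ps); split.
- by rewrite size_map size_filter.
- move=> _ /mapP[P /psP[PX szP _] ->].
  by rewrite npts_on_line_of; split=> //; exact/line_of_valid/X_valid.
- move=> a b ab; have sz : size (map line_of ps) = size ps by rewrite size_map.
  have ia : (a < size ps)%N by rewrite -sz.
  have ib : (b < size ps)%N by rewrite -sz.
  pose d : pt3 K := (0, 0, (0, 0)).
  rewrite !(nth_map d) // => ll; case/negP: ab.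
  have := mem_nth d ia; have := mem_nth d ib.
  set P := nth d ps a; set Q := nth d ps b => /psP[QX _ Qm] /psP[PX _ Pm].
  (* The same line means the same fiber, and within a fiber the rank determines the point. *)
  have PQ : same_fiber P Q.
    have := ll Q (X_valid QX); rewrite !on_line_of => ->.
    by rewrite /same_fiber !eq1_refl.
  have fPQ := fiber_eq (X_valid PX) (X_valid QX) PQ.
  have : P == Q.
    rewrite -(nth_index d (fiber_mem PX)) -(nth_index d (fiber_mem QX)).
    by rewrite -/(fiber_rank P) -/(fiber_rank Q) Pm Qm fPQ.
  by rewrite nth_uniq ?filter_uniq.
move=> M vM nM; pose s := [seq Q <- X | on_line M Q].
have sz_s : size s = n by rewrite size_filter.
(* The point of rank [m] on [M], which exists because [m < n]. *)
pose P := nth (0, 0, (0, 0)) s m.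
have /[dup] Ps : P \in s by rewrite mem_nth ?sz_s.
rewrite mem_filter => /andP[MP PX].
have fP : fiber P = s.
  by apply: eq_filter => Q; rewrite (on_line_fiber _ vM (X_valid PX) MP).
exists (line_of P).
  apply/mapP; exists P => //; rewrite mem_filter PX andbT /p fP sz_s eqxx /=.
  by rewrite /fiber_rank fP index_uniq ?sz_s // filter_uniq.
by move=> Q vQ; rewrite on_line_of (on_line_fiber _ vM (X_valid PX) MP).
Qed.

Lemma count_by (T : eqType) (s : seq T) (p : pred T) (g : T -> nat) lo hi :
  {in s, forall x, p x -> (lo <= g x < hi)%N} ->
  (\sum_(lo <= n < hi) count (fun x => p x && (g x == n)) s)%N = count p s.
Proof.
elim: s => [|x s IH] g_lt /=; first by rewrite big1.
rewrite big_split /= IH; last by move=> y ys; apply: g_lt; rewrite inE ys orbT.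
congr (_ + _)%N; case: (boolP (p x)) => px /=; last by rewrite big1.
under eq_bigr => n _ do rewrite eq_sym.
under eq_bigr => n _ do rewrite -[nat_of_bool _]/(if n == g x then 1 else 0)%N.
by rewrite -big_mkcond big_nat1_eq g_lt ?mem_head.
Qed.

(** Points of rank [m - 1] correspond to lines with at least [m] points; sort the points by rank,
    then by fiber size. *)
Lemma sum_r k :
  (\sum_(1 <= m < k.+2) \sum_(m <= n < (size X).+1) r X n)%N =
  count (fun P => (fiber_rank P <= k)%N) X.
Proof.
rewrite -(@count_by _ _ _ (fun P => (fiber_rank P).+1) 1 k.+2) //.
apply: eq_big_nat => m /andP[m0 mk].
transitivity (count (fun P => fiber_rank P == m.-1) X); last first.
  apply: eq_count => P; case: m m0 mk => // m _ mk /=.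
  by rewrite eqSS; case: eqP => [->|]; rewrite ?andbF // andbT; lia.
rewrite -(@count_by _ _ _ (fun P => size (fiber P)) m (size X).+1).
  apply: eq_big_nat => n /andP[mn _]; rewrite (@r_count m.-1) ?prednK //.
  by apply: eq_count => P; rewrite andbC.
(* A fiber with a point of rank [m - 1] has at least [m] points, and at most [size X]. *)
move=> P PX /eqP Pm; rewrite ltnS size_filter count_size andbT -size_filter.
by rewrite -(prednK m0) -Pm index_mem fiber_mem.
Qed.

End Counting.

(** * The Hilbert function as the number of leading points *)

Section Hilbert.
Variables (K : closedFieldType) (X : seq (pt3 K)).
Implicit Types (P Q : pt3 K).
Hypothesis X_valid : forall P, P \in X -> valid3 P.
Hypothesis X_uniq : uniq X.
Hypothesis X_eq3 : {in X &, forall P Q, eq3 P Q -> P = Q}.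
Variable k : nat.

Definition leading := [seq P <- X | (fiber_rank X P <= k)%N].

Lemma leading_sub : {subset leading <= X}.
Proof. by move=> P; rewrite mem_filter => /andP[]. Qed.

Lemma take_fiber P Q : P \in X -> Q \in X -> same_fiber P Q ->
  (Q \in take k.+1 (fiber X P)) = (Q \in leading).
Proof.
move=> PX QX PQ; rewrite (fiber_eq _ (X_valid PX) (X_valid QX) PQ).
by rewrite in_take ?fiber_mem // mem_filter QX andbT.
Qed.

Lemma fiber_snd_inj P : P \in X -> {in fiber X P &, forall Q S, eq1 Q.2 S.2 -> Q = S}.
Proof.
move=> PX Q S; rewrite !mem_filter => /andP[PQ QX] /andP[PS SX] QS.
apply: X_eq3 => //.
have /andP[QSx QSy] : same_fiber Q S.
  by apply: same_fiber_trans PS; [exact: X_valid | rewrite same_fiber_sym].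
by rewrite /eq3 QSx QSy QS.
Qed.

(** If [P] is not leading, its rank exceeds [k], so the first [k + 1] points of its line are zeros
    of [f] and [fiber_zeros] applies. *)
Lemma leading_vanish (i j : int) f P : homog3 i j k%:Z f ->
  (forall Q, Q \in leading -> f.@[coords Q] = 0) -> P \in X -> f.@[coords P] = 0.
Proof.
move=> f_homog f0 PX; have [vPx vPy vPz] := X_valid PX.
case: (boolP (P \in leading)) => [/f0//|].
rewrite mem_filter PX andbT -ltnNge => kP.
have szP : (k.+1 <= size (fiber X P))%N.
  by apply: leq_trans kP _; rewrite index_size.
have in_fiber Q : Q \in take k.+1 (fiber X P) ->
    [/\ Q \in fiber X P, Q \in X, same_fiber P Q & Q \in leading].
  move=> Qt; have Qf := mem_take Qt.
  have := Qf; rewrite {1}mem_filter => /andP[PQ QX].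
  by split=> //; rewrite -(take_fiber PX QX PQ).
have -> : P = (P.1.1, P.1.2, P.2) by case: (P) => -[].
apply: (fiber_zeros f_homog vPx vPy vPz (C := [seq Q.2 | Q <- take k.+1 (fiber X P)])).
- by move=> _ /mapP[Q /in_fiber[_ /X_valid[_ _ ?] _ _] ->].
- rewrite map_inj_in_uniq ?take_uniq ?filter_uniq // => Q S /in_fiber[Qf _ _ _] /in_fiber[Sf _ _ _] QS.
  by apply: (fiber_snd_inj PX) => //; rewrite QS eq1_refl.
- move=> _ _ /mapP[Q /in_fiber[Qf _ _ _] ->] /mapP[S /in_fiber[Sf _ _ _] ->] QS.
  by rewrite (fiber_snd_inj PX Qf Sf QS).
- by rewrite size_map size_takel.
move=> _ /mapP[Q /in_fiber[_ QX /andP[PQx PQy] Ql] ->].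
(* [Q] and [(P.1.1, P.1.2, Q.2)] are coordinates of the same point. *)
apply: (@idealP_vanish _ Q).
  exact: vanish_idealP (X_valid QX) f_homog (f0 _ Ql).
by rewrite /eq3 eq1_sym PQx eq1_sym PQy eq1_refl.
Qed.

(** Multiply the forms of all projected points except that of [P]: at most one factor fewer than
    there are classes. *)
Lemma projection_form (pr : pt3 K -> pt1 K) (L : pt1 K -> R K) (i j l : int) P :
  (forall Q, Q \in X -> nz1 (pr Q)) ->
  (forall a, homog3 i j l (L a)) ->
  (forall a Q, ((L a).@[coords Q] == 0) = eq1 a (pr Q)) ->
  P \in X ->
  let d := (nclasses (@eq1 K) (0%R, 0%R) [seq pr Q | Q <- X])%:Z - 1 in
  exists f, [/\ homog3 (d * i) (d * j) (d * l) f, f.@[coords P] != 0 &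
    forall Q, Q \in X -> ~~ eq1 (pr P) (pr Q) -> f.@[coords Q] = 0].
Proof.
move=> nz_pr L_homog L_eq0 PX.
have [|A [<- AX A_reps]] := @nclasses_reps _ [seq pr Q | Q <- X].
  by move=> _ /mapP[Q QX ->]; exact: nz_pr.
have [a0 a0A a0P] := A_reps _ (map_f pr PX).
pose B := [seq a <- A | ~~ eq1 a (pr P)].
have szB : (size B <= (size A).-1)%N.
  have A_P : (0 < count (fun a => eq1 a (pr P)) A)%N.
    by rewrite -has_count; apply/hasP; exists a0.
  rewrite size_filter -(count_predC (fun a => eq1 a (pr P))).
  by rewrite -(prednK A_P) addSn leq_addl.
have A_gt0 : (0 < size A)%N by case: (A) a0A.
have [|f [f_homog fP f0]] := separating_form L_homog L_eq0 szB (nz_pr _ PX).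
  by move=> a; rewrite mem_filter => /andP[].
rewrite -(prednK A_gt0) intS addrAC subrr add0r.
exists f; split=> // Q QX PQ.
have [a aA aQ] := A_reps _ (map_f pr QX).
apply: (f0 Q a) => //; rewrite mem_filter aA andbT; apply: contra PQ => aP.
have /mapP[S SX aS] := AX _ aA.
by apply: (eq1_trans (b := a)) => //; [rewrite aS; exact: nz_pr | rewrite eq1_sym].
Qed.

(** [fx] and [fy] kill the points on other lines; [fz] kills the at most [k] other leading points on
    the line of [P]. *)
Lemma leading_separated P : P \in leading ->
  exists f, [/\ homog3 ((t1 X)%:Z - 1) ((t2 X)%:Z - 1) k%:Z f, f.@[coords P] != 0 &
    forall Q, Q \in leading -> Q != P -> f.@[coords Q] = 0].
Proof.
move=> Pl; have PX := leading_sub Pl.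
have [|fx [fx_homog fxP fx0]] := projection_form _ (@homog3_xform K) (@xform_eq0 K) PX.
  by move=> Q /X_valid[].
have [|fy [fy_homog fyP fy0]] := projection_form _ (@homog3_yform K) (@yform_eq0 K) PX.
  by move=> Q /X_valid[].
have Pt : P \in take k.+1 (fiber X P).
  by rewrite take_fiber // /same_fiber !eq1_refl.
have t_uniq : uniq (take k.+1 (fiber X P)) by rewrite take_uniq // filter_uniq.
pose C := [seq Q.2 | Q <- rem P (take k.+1 (fiber X P))].
have szC : (size C <= k)%N.
  by rewrite size_map size_rem // size_take; case: ltnP => //; lia.
have [_ _ vPz] := X_valid PX.
have [|fz [fz_homog fzP fz0]] :=
    separating_form (@homog3_zform K) (@zform_eq0 K) szC vPz.
  move=> _ /mapP[Q Qt ->]; move: Qt; rewrite mem_rem_uniq // inE => /andP[QP Qt].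
  by apply: contra QP => QP; apply/eqP/(fiber_snd_inj PX); rewrite // (mem_take Qt, mem_take Pt).
exists (fx * fy * fz); split.
- have := homog3M (homog3M fx_homog fy_homog) fz_homog.
  by rewrite !mulr0 !mulr1 !addr0 !add0r.
- by rewrite !mevalM !mulf_neq0.
move=> Q Ql QP; have QX := leading_sub Ql; rewrite !mevalM.
case: (boolP (eq1 P.1.1 Q.1.1)) => PQx; last by rewrite fx0 // !mul0r.
case: (boolP (eq1 P.1.2 Q.1.2)) => PQy; last by rewrite fy0 // mulr0 mul0r.
rewrite (fz0 Q Q.2) ?eq1_refl ?mulr0 //; apply: map_f.
by rewrite mem_rem_uniq // inE QP take_fiber // /same_fiber PQx.
Qed.

Lemma hilbX_leading : hilbX X ((t1 X)%:Z - 1) ((t2 X)%:Z - 1) k%:Z = (size leading)%:Z.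
Proof.
(* Total degree at most [d] makes the list [ms] of monomials finite. Degrees are compared as
   integers, so for empty [X], where [i] and [j] are -1, [ms] is empty. *)
set i := _ - 1; set j := _ - 1; pose d := (absz i + absz j + k)%N.
pose deg_ijk (m : 'X_{1..6}) := [&& (m v0 + m v1)%N%:Z == i, (m v2 + m v3)%N%:Z == j
  & (m v4 + m v5)%N%:Z == k%:Z].
pose ms := [seq val m | m <- enum {: 'X_{1..6 < d.+1}} & deg_ijk (val m)].
have msE m : (m \in ms) = deg_ijk m.
  apply/mapP/idP => [[m' m'P ->]|mP]; first by move: m'P; rewrite mem_filter => /andP[].
  have m_d : (mdeg m < d.+1)%N.
    rewrite mdegE big_ord6 /=; move: mP => /and3P[/eqP mi /eqP mj /eqP mk].
    by rewrite /d; lia.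
  by exists (BMultinom m_d); rewrite // mem_filter mem_enum andbT.
pose o : pt3 K := (0, 0, (0, 0)).
apply: (@dimK_codim _ ms _ _ (fun y : 'I_(size leading) => coords (nth o leading y))).
- by rewrite map_inj_uniq; [exact/filter_uniq/enum_uniq | exact: val_inj].
- move=> f; split=> f_homog m /f_homog; rewrite msE.
    by case=> mi mj mk; apply/and3P; split; apply/eqP.
  by case/and3P=> /eqP mi /eqP mj /eqP mk; split.
- move=> f; split=> [[f_homog fX]|[f_homog f0]]; split=> //.
    move=> y; have yX := leading_sub (mem_nth o (ltn_ord y)).
    by apply: (idealP_vanish (fX _ yX)); rewrite /eq3 !eq1_refl.
  move=> P PX; apply: (vanish_idealP (X_valid PX) f_homog).
  apply: (leading_vanish f_homog) PX => Q /(nthP o)[y yl <-].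
  exact: (f0 (Ordinal yl)).
move=> y; have [f [f_homog fy f0]] := leading_separated (mem_nth o (ltn_ord y)).
exists f => // y'; case: (eqVneq y' y) => [->//|yy'].
by rewrite f0 ?eqxx ?mem_nth // nth_uniq ?filter_uniq.
Qed.

End Hilbert.

Theorem theorem3p4 (K : closedFieldType) (charK0 : [pchar K] =i pred0)
  (X : seq (pt3 K)) (hX : distinct_points X) (k : nat) :
  hilbX X ((t1 X)%:Z - 1) ((t2 X)%:Z - 1) k%:Z =
  (\sum_(1 <= m < k.+2) \sum_(m <= n < (size X).+1) r X n)%N%:Z.
Proof.
case: hX => X_valid X_neq; pose o : pt3 K := ((0, 0), (0, 0), (0, 0)).
have X_neq_nth a b : (a < size X)%N -> (b < size X)%N -> eq3 (nth o X a) (nth o X b) ->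
    a = b.
  move=> ha hb; apply: contraTeq => ab.
  exact: (X_neq (Ordinal ha) (Ordinal hb)).
have X_uniq : uniq X.
  by apply/(uniqP o) => a b ha hb ab; apply: X_neq_nth; rewrite // ab /eq3 !eq1_refl.
have X_eq3 : {in X &, forall P Q, eq3 P Q -> P = Q}.
  move=> _ _ /(nthP o)[a ha <-] /(nthP o)[b hb <-] ab.
  by rewrite (X_neq_nth a b).
by rewrite hilbX_leading // sum_r // /leading size_filter.
Qed.
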